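(* Let $M\geq 2$ be an integer and let $q$ be a prime power with $(q,M)=1$. Let $\alpha\in\mathrm{GL}(n,q)$ with combinatorial data $\Delta_\alpha$ consisting of polynomials $f_i$ and partitions $\lambda_{f_i}$. Suppose each partition $\lambda_{f_i}$ in $\Delta_\alpha$ has all its parts distinct. Then $X^M=\alpha$ has a solution in $\mathrm{GL}(n,q)$ if and only if $f_i$ is an M-power polynomial for all $i$ (that is, $f_i(x^M)$ has an irreducible factor of degree $\deg(f_i)$ for all $i$).
   Context: $\mathrm{GL}(n,q)$ is the group of invertible $n\times n$ matrices over the field $\mathbb F_q$ with $q$ elements. Let $\Phi$ be the set of monic irreducible polynomials of degree $\geq 1$ over $\mathbb F_q$ other than $x$. The conjugacy class of $\alpha\in\mathrm{GL}(n,q)$ is determined by its combinatorial data $\Delta_\alpha$: distinct $f_1,\dots,f_l\in\Phi$ with non-empty partitions $\lambda_{f_i}=(\lambda_{i_1},\lambda_{i_2},\dots)$ satisfying $\sum_i|\lambda_{f_i}|\deg f_i=n$, meaning that the $\mathbb F_q[x]$-module $\mathbb F_q^n$ defined by $\alpha$ is isomorphic to $\bigoplus_{i,j}\mathbb F_q[x]/(f_i^{\lambda_{i_j}})$. A monic irreducible $f\in\mathbb F_q[x]$ is an M-power polynomial if $f(x^M)$ has an irreducible factor of degree $\deg f$. *)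

(* Defs.v *)
From HB Require Import structures.
From mathcomp Require Import all_boot all_order all_fingroup all_algebra.

Set Implicit Arguments.
Unset Strict Implicit.
Unset Printing Implicit Defensive.

Import GRing.Theory.
Local Open Scope ring_scope.

Section CombinatorialData.

Variable F : finFieldType.

Definition in_Phi (f : {poly F}) : Prop :=
  [/\ f \is monic, irreducible_poly f & f != 'X].

Definition is_partition (lam : seq nat) : bool :=
  sorted geq lam && (0%N \notin lam).

(* f_i ^ lam_{i,j}, with k the pair (i, j).  The library's quotient
   [{poly %/ h}] is the expected one only for h monic of degree >= 1,
   which is the case below since f_i is in Phi and lam_{i,j} > 0. *)
Definition cyclic_modulus l (f : 'I_l -> {poly F}) (lam : 'I_l -> seq nat)
    (k : {i : 'I_l & 'I_(size (lam i))}) : {poly F} :=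
  f (tag k) ^+ nth 0%N (lam (tag k)) (tagged k).

(* F^n, where x acts on column vectors as A, is isomorphic as an F[x]-module
   to the direct sum of the F[x]/(h k), k in the finite type K. *)
Definition module_iso_sum_cyclic n (A : 'M[F]_n.+1) (K : finType)
    (h : K -> {poly F}) : Prop :=
  exists phi : 'cV[F]_n.+1 -> {ffun forall k : K, {poly %/ h k}},
    [/\ bijective phi,
        forall (u v : 'cV[F]_n.+1) k, phi (u + v) k = phi u k + phi v k
      & forall (p : {poly F}) v k,
          phi (horner_mx A p *m v) k = in_qpoly (h k) p * phi v k].

Definition comb_data n (alpha : {'GL_n[F]}) l
    (f : 'I_l -> {poly F}) (lam : 'I_l -> seq nat) : Prop :=
  [/\ injective f /\ (forall i, in_Phi (f i)),
      forall i, is_partition (lam i) /\ lam i != [::],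
      (\sum_i sumn (lam i) * (size (f i)).-1)%N = n
    & module_iso_sum_cyclic (GLval alpha) (@cyclic_modulus l f lam)].

(* Meant for f monic irreducible.  [size g = size f] says deg g = deg f, and
   [f \Po 'X^M] is f(x^M). *)
Definition M_power_poly (M : nat) (f : {poly F}) : Prop :=
  exists g : {poly F},
    [/\ irreducible_poly g, g %| f \Po 'X^M & size g = size f].

End CombinatorialData.

(* Main.v *)
Require Import Defs.
From mathcomp Require Import all_boot all_order all_fingroup all_algebra.
From mathcomp Require Import cyclic ring.

(** Write [K] for the field F[x]/(f), with f monic irreducible of degree d and
    different from x.  Both directions pass through the condition that x has an
    M-th root in [K], that is, f divides r^M - x for some polynomial r.

    This condition is equivalent to f being an M-power polynomial
    ([M_power_polyP]).  If r^M = x in [K], then r generates [K], so that its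
    minimal polynomial g has degree d, and g divides f(x^M) because
    f(r^M) = f(x) = 0.  Conversely, a root b of a degree d irreducible factor g
    of f(x^M) generates a field of degree d in which b^M is a root of f; hence
    F(b^M) = F(b), and the polynomial expressing b in b^M is the root r.

    Given such roots for all the f_i, Hensel's lemma ([hensel_root], where
    coprimality of q and M enters) lifts them modulo powers of the f_i, and the
    Chinese remainder theorem ([chinese_poly]) glues them into one polynomial P
    such that P^M - x is divisible by every modulus f_i^(lam_ij).  Then
    P(alpha)^M = alpha.

    Given X^M = alpha, the matrix X is an endomorphism of the F[x]-module
    defined by alpha.  Let a + 1 be the largest part of the partition of f.  It
    occurs once, so the vectors that are killed by f(alpha) and lie in the image
    of f(alpha)^a form a single copy of [K].  Being K-linear, X acts on this
    line as an element r of [K] ([exists_common_eigenvector]), and X^M = alpha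
    reads r^M = x there. *)

Set Implicit Arguments.
Unset Strict Implicit.
Unset Printing Implicit Defensive.

Import GRing.Theory.
Local Open Scope ring_scope.

(** * Polynomials modulo an irreducible polynomial *)

(** Since g divides f(s), composition with s induces a ring morphism from
    F[x]/(f) to F[x]/(g); it is injective because its source is a field. *)
Lemma dvdp_comp_irreducible (F : fieldType) (f g s p : {poly F}) :
  irreducible_poly f -> (1 < size g)%N -> g %| f \Po s ->
  (g %| p \Po s) = (f %| p).
Proof.
move=> irr_f g_gt1 g_fs; apply/idP/idP => [g_ps|f_p].
  apply: contraTT g_gt1; rewrite -irreducible_poly_coprime // => co_fp.
  have /coprimepP/(_ g g_fs g_ps) := coprimep_comp_poly s co_fp.
  by rewrite -size_poly_eq1 => /eqP->.
by apply: dvdp_trans g_fs _; apply: dvdp_comp_poly.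
Qed.

(** The morphism F[x]/(f) -> F[x]/(g) given by composition with s, with residues
    encoded as coefficient vectors.  Over a finite field, its injectivity
    compares the degrees of f and g, and yields surjectivity when these agree;
    this replaces the degree theory of field extensions. *)
Section ResidueComp.

Variables (F : finFieldType) (f g s : {poly F}).
Hypotheses (irr_f : irreducible_poly f) (g_gt1 : (1 < size g)%N).
Hypothesis g_fs : g %| f \Po s.

Definition residue_comp (v : 'rV[F]_(size f).-1) : 'rV[F]_(size g).-1 :=
  poly_rV ((rVpoly v \Po s) %% g).

Lemma dvdp_residue_comp v w :
  residue_comp v = poly_rV (w %% g) -> g %| (rVpoly v \Po s) - w.
Proof.
have small p : (size (p %% g)%R <= (size g).-1)%N.
  by rewrite -ltnS prednK ?ltn_modp -?size_poly_gt0 ltnW.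
move=> /(congr1 rVpoly); rewrite !poly_rV_K // => eq_mod.
by rewrite /dvdp modpD modpN eq_mod subrr.
Qed.

Lemma residue_comp_inj : injective residue_comp.
Proof.
move=> v w /dvdp_residue_comp; rewrite -rmorphB /=.
rewrite (dvdp_comp_irreducible _ irr_f g_gt1 g_fs) -linearB => f_vw.
apply/eqP; rewrite -subr_eq0 -[v - w]rVpolyK.
have [->|nz] := eqVneq (rVpoly (v - w)) 0; first by rewrite linear0.
have := dvdp_leq nz f_vw; rewrite leqNgt (leq_ltn_trans (size_poly _ _)) //.
by rewrite prednK // ltnW //; case: irr_f.
Qed.

Lemma size_dvdp_comp_leq : (size f <= size g)%N.
Proof.
have := leq_card _ residue_comp_inj.
rewrite !card_mx !mul1n leq_exp2l; last exact: card_finNzRing_gt1.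
have [f_gt1 _] := irr_f.
by rewrite -(prednK (ltnW f_gt1)) -(prednK (ltnW g_gt1)) ltnS.
Qed.

Lemma comp_modp_onto w : size g = size f -> exists r, g %| (r \Po s) - w.
Proof.
move=> eq_size.
have : poly_rV (w %% g) \in codom residue_comp.
  by apply: inj_card_onto residue_comp_inj _ _; rewrite !card_mx eq_size.
by case/codomP=> v /esym/dvdp_residue_comp; exists (rVpoly v).
Qed.

End ResidueComp.

Lemma dvdp_comp_congr (F : fieldType) (f p r s : {poly F}) :
  f %| r - s -> f %| (p \Po r) - (p \Po s).
Proof.
move=> f_rs; elim/poly_ind: p => [|p c IHp].
  by rewrite !comp_poly0 subrr dvdp0.
rewrite !comp_poly_MXaddC.
move: (p \Po r) (p \Po s) IHp => pr ps IHp.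
have -> : pr * r + c%:P - (ps * s + c%:P) = (pr - ps) * r + ps * (r - s).
  by ring.
by apply: dvdp_add; [apply: dvdp_mulr | apply: dvdp_mull].
Qed.

Lemma dvdp_mul_irreducible (F : fieldType) (f p q : {poly F}) :
  irreducible_poly f -> (f %| p * q) = (f %| p) || (f %| q).
Proof.
move=> irr_f; apply/idP/orP => [f_pq|[]]; last 2 first.
- exact: dvdp_mulr.
- exact: dvdp_mull.
have [/=|] := boolP (f %| p); first by left.
by rewrite -irreducible_poly_coprime // => /Gauss_dvdpr <-; right.
Qed.

(** The factor g is, up to a scalar, the minimal polynomial of the class of r in
    F[x]/(f): as f is prime, some irreducible factor of h vanishes at r. *)
Lemma exists_irreducible_dvdp_comp (F : finFieldType) (f r h : {poly F}) :
  irreducible_poly f -> h != 0 -> f %| h \Po r ->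
  exists g, [/\ irreducible_poly g, g %| h & f %| g \Po r].
Proof.
move=> irr_f; have [m] := ubnP (size h).
elim: m h => // m IHm h h_m h0 f_hr.
have h_gt1 : (1 < size h)%N.
  rewrite ltnNge; apply/negP => /size1_polyC eq_h.
  move: f_hr h0; rewrite eq_h comp_polyC => f_c c0.
  have [f_gt1 _] := irr_f; have := leq_trans f_gt1 (dvdp_leq c0 f_c).
  by rewrite ltnNge size_polyC_leq1.
case: (boolP (irreducibleb h)) => [/irreducibleP irr_h|]; first by exists h.
rewrite /irreducibleb h_gt1 /= negb_forall => /existsP[q].
rewrite negb_imply -dvdpE -ltnNge => /andP[/dvdpP[k eq_h] q_gt1].
have q_lt : (size (q : {poly F}) < size h)%N.
  by rewrite (leq_ltn_trans (size_npoly q)) // prednK // ltnW.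
have [k0 q0] : k != 0 /\ (q : {poly F}) != 0.
  by apply/andP; rewrite -negb_or -mulf_eq0 -eq_h.
have k_lt : (size k < size h)%N.
  rewrite eq_h size_mul // -(subnKC q_gt1).
  by rewrite !addnS /= ltnS leq_addr.
move: f_hr; rewrite eq_h rmorphM /= dvdp_mul_irreducible // => /orP[] f_dvd.
- have [g [irr_g g_k f_g]] := IHm k (leq_trans k_lt h_m) k0 f_dvd.
  by exists g; rewrite dvdp_mulr.
- have [g [irr_g g_k f_g]] := IHm q (leq_trans q_lt h_m) q0 f_dvd.
  by exists g; rewrite dvdp_mull.
Qed.

(** * M-power polynomials *)

(** The polynomial r stands for an M-th root of x in F[x]/(f).
    Composition with r and with 'X^M embeds F[x]/(g) into F[x]/(f) and F[x]/(f)
    into F[x]/(g), which is why f and g have the same degree. *)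
Lemma M_power_polyP (F : finFieldType) (M : nat) (f : {poly F}) :
  (0 < M)%N -> irreducible_poly f ->
  M_power_poly M f <-> exists r, f %| r ^+ M - 'X.
Proof.
move=> M_gt0 irr_f; split=> [[g [irr_g g_f eq_size]]|[r f_r]].
  have [g_gt1 _] := irr_g.
  have [r g_r] := comp_modp_onto irr_f g_gt1 g_f 'X eq_size.
  (* r('X^M) is 'X modulo g, and divisibility of r^M - 'X by f can be tested
     modulo g after substituting 'X^M. *)
  exists r; rewrite -(dvdp_comp_irreducible _ irr_f g_gt1 g_f).
  by rewrite rmorphB rmorphXn /= comp_polyX subrXX dvdp_mulr.
have [f_gt1 _] := irr_f.
have f_Xr : f %| (f \Po 'X^M) \Po r.
  rewrite -comp_polyA comp_Xn_poly -(subrK f (f \Po _)) dvdp_add //.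
  by have := dvdp_comp_congr f f_r; rewrite comp_polyXr.
have [|g [irr_g g_f f_g]] := exists_irreducible_dvdp_comp irr_f _ f_Xr.
  by rewrite comp_poly_eq0 ?irredp_neq0 // size_polyXn.
exists g; split=> //; have [g_gt1 _] := irr_g.
by apply/eqP; rewrite eqn_leq (size_dvdp_comp_leq irr_g f_gt1 f_g)
  (size_dvdp_comp_leq irr_f g_gt1 g_f).
Qed.

(** * Lifting and gluing roots *)

Lemma natr_coprime_card_neq0 (F : finFieldType) (M : nat) :
  coprime #|F| M -> M%:R != 0 :> F.
Proof.
move=> co_qM; have card0 : #|F|%:R = 0 :> F.
  (* Lagrange's theorem in the additive group of F. *)
  have /= := expg_cardG (in_setT (1 : F)).
  by rewrite FinRing.zmodXgE cardsT.
have q_gt0 : (0 < #|F|)%N by apply/card_gt0P; exists 0.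
apply/eqP => M0; have [u v eq_uv _] := egcdnP M q_gt0.
move/(congr1 (fun k => k%:R : F)): eq_uv.
rewrite natrD !natrM card0 M0 !mulr0 add0r (eqP co_qM) => /esym/eqP.
by rewrite oner_eq0.
Qed.

Lemma exprD_taylor1 (R : comNzRingType) (x y : R) m :
  exists z, (x + y) ^+ m.+1 = x ^+ m.+1 + m.+1%:R * x ^+ m * y + y ^+ 2 * z.
Proof.
elim: m => [|m [z eq_z]]; first by exists 0; rewrite !expr1 expr0; ring.
exists (m.+1%:R * x ^+ m + (x + y) * z).
rewrite [in LHS]exprS eq_z !exprS -[in m.+2%:R]addn1 natrD.
move: (x ^+ m) (m.+1%:R : R) => p c.
by rewrite expr0; ring.
Qed.

(** Hensel's lemma for the equation s^M = x.  The derivative M s^(M-1) is a unit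
    modulo f: M is invertible in F, and s is coprime to f because s^M is
    congruent to x, which is coprime to f. *)
Lemma hensel_root (F : fieldType) (M : nat) (f r : {poly F}) (a : nat) :
  M%:R != 0 :> F -> coprimep f 'X -> f %| r ^+ M - 'X ->
  exists s, f ^+ a %| s ^+ M - 'X.
Proof.
case: M => [|m M0 co_fX f_r]; first by rewrite eqxx.
suff [s] : exists s, f ^+ a.+1 %| s ^+ m.+1 - 'X.
  by exists s; apply: dvdp_trans p; rewrite exprS dvdp_mull.
elim: a => [|a [s f_s]]; first by exists r; rewrite expr1.
set E := s ^+ m.+1 - 'X in f_s.
have f_E : f %| E by apply: dvdp_trans f_s; rewrite exprS dvdp_mulr.
have co_fs : coprimep f (m.+1%:R * s ^+ m).
  rewrite -polyC_natr mul_polyC coprimepZr //.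
  have : coprimep f (s ^+ m.+1).
    by rewrite -[s ^+ _](subrK 'X) -/E -(divpK f_E) coprimep_addl_mul.
  by rewrite exprS coprimepMr => /andP[].
have /Bezout_eq1_coprimepP[[u v] /= eq1] := co_fs.
have [w eq_w] := exprD_taylor1 s (- (v * E)) m.
(* The Newton step: v inverts the derivative M s^(M-1) modulo f. *)
exists (s - v * E).
have -> : (s - v * E) ^+ m.+1 - 'X = u * (f * E) + (E * E) * (v ^+ 2 * w).
  rewrite eq_w mulrA -(addrK (v * (m.+1%:R * s ^+ m)) (u * f)) eq1.
  rewrite -[in LHS](subrK 'X (s ^+ m.+1)) -/E.
  by move: (s ^+ m) (m.+1%:R : {poly F}) (E) => p c e; ring.
by apply: dvdp_add; [apply: dvdp_mull | apply: dvdp_mulr];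
  rewrite exprS dvdp_mul.
Qed.

Lemma chinese_poly (F : fieldType) (I : finType) (h c : I -> {poly F}) :
  (forall i j, i != j -> coprimep (h i) (h j)) ->
  exists P, forall i, h i %| P - c i.
Proof.
move=> co_h.
have idem i : exists e, h i %| e - 1 /\ forall j, j != i -> h j %| e.
  set N := \prod_(j | j != i) h j; have : coprimep (h i) N.
    rewrite /N; elim/big_rec: _ => [|j p ne_ji co_p]; first exact: coprimep1.
    by rewrite coprimepMr co_p andbT co_h // eq_sym.
  case/Bezout_eq1_coprimepP=> [[u v] /= eq1].
  exists (v * N); split=> [|j ne_ji].
    by rewrite -eq1 opprD addrC subrK dvdpNr dvdp_mull.
  by rewrite /N (bigD1 j) //= dvdp_mull // dvdp_mulr.
have [e e_ok] := fin_all_exists idem.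
exists (\sum_i e i * c i) => i; have [e_i _] := e_ok i.
rewrite (bigD1 i) //= addrAC -{2}[c i]mul1r -mulrBl dvdp_add ?dvdp_mulr //.
elim/big_rec: _ => [|j p ne_ji h_p]; first exact: dvdp0.
by rewrite dvdp_add // dvdp_mulr //; apply: (e_ok j).2; rewrite eq_sym.
Qed.

(** * The F[x]-module defined by a matrix *)

Lemma in_qpoly_eq0 (F : fieldType) (h p : {poly F}) :
  h \is monic -> (1 < size h)%N -> (in_qpoly h p == 0) = (h %| p).
Proof.
move=> h_monic h_gt1.
by rewrite -val_eqE /= /mk_monic h_gt1 h_monic dvdpE.
Qed.

Lemma in_qpoly_onto (F : fieldType) (h : {poly F}) (y : {poly %/ h}) :
  exists p, in_qpoly h p = y.
Proof.
exists (y : {poly F}); apply/val_inj/in_qpoly_small/size_mk_monic.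
Qed.

Section CyclicDecomposition.

Variables (F : finFieldType) (n : nat) (A : 'M[F]_n.+1).
Variables (K : finType) (h : K -> {poly F}).
Hypothesis h_monic : forall k, h k \is monic.
Hypothesis h_gt1 : forall k, (1 < size (h k))%N.
Hypothesis decA : module_iso_sum_cyclic A h.

Lemma horner_mx_eq0_cyclic p :
  (forall k, h k %| p) -> horner_mx A p = 0.
Proof.
have [phi [bij_phi phiD phiM]] := decA => h_p.
have phi0 k : phi 0 k = 0.
  by apply: (addrI (phi 0 k)); rewrite -phiD !addr0.
apply/matrixP => i j; rewrite mxE.
suff /matrixP/(_ i 0) : horner_mx A p *m delta_mx j 0 = 0 :> 'cV_n.+1.
  by rewrite -colE !mxE.
apply: (bij_inj bij_phi); apply/ffunP => k; rewrite phi0 phiM.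
by have := h_p k; rewrite -in_qpoly_eq0 // => /eqP->; rewrite mul0r.
Qed.

(** The summand F[x]/(f^(a+1)) at k0 is the only one with nonzero multiples of
    f^a killed by f: on another summand f is invertible or f^a is zero.  Hence
    the vectors that are killed by f(A) and lie in the image of f(A)^a form a
    line over F[x]/(f).  This line is defined from A alone, so every Y commuting
    with A preserves it and acts on it as a polynomial in A.  The second
    conjunct says that v is a nonzero vector of this line. *)
Lemma exists_common_eigenvector Y k0 f a :
    irreducible_poly f -> h k0 = f ^+ a.+1 ->
    (forall k, k != k0 -> coprimep (h k) f \/ h k %| f ^+ a) ->
    comm_mx A Y ->
  exists (v : 'cV[F]_n.+1) (r : {poly F}),
    Y *m v = horner_mx A r *m v /\
    forall p, horner_mx A p *m v = 0 -> f %| p.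
Proof.
move=> irr_f h_k0 h_k commAY.
have [phi [[psi phiK psiK] phiD phiM]] := decA.
have phi0 k : phi 0 k = 0.
  by apply: (addrI (phi 0 k)); rewrite -phiD !addr0.
pose w := psi [ffun k => if k == k0 then 1 else 0].
have phi_w k : phi w k = if k == k0 then 1 else 0 by rewrite /w psiK ffunE.
pose v := horner_mx A (f ^+ a) *m w.
have ann p : horner_mx A p *m v = 0 -> f %| p.
  rewrite /v mulmxA -[_ *m horner_mx _ _]rmorphM => /(congr1 (phi ^~ k0)).
  rewrite phiM phi0 phi_w eqxx mulr1 => /eqP.
  rewrite in_qpoly_eq0 // h_k0 exprS dvdp_mul2r //.
  by rewrite expf_neq0 // irredp_neq0.
(* w generates the summand at k0, and f^a sends Y w into that summand; so only
   the component r of Y w at k0 matters for Y v. *)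
have [r phi_Yw] := in_qpoly_onto (phi (Y *m w) k0).
exists v, r; split=> //; apply: (can_inj phiK); apply/ffunP => k.
have commY p : Y *m horner_mx A p = horner_mx A p *m Y.
  by apply/esym/comm_horner_mx.
have Yv : Y *m v = horner_mx A (f ^+ a) *m (Y *m w).
  by rewrite /v !mulmxA commY.
rewrite Yv /v mulmxA -[_ *m horner_mx _ _]rmorphM mulrC rmorphM -mulmxA.
rewrite !phiM phi_w.
have [->|ne_k] := eqVneq k k0; first by rewrite mulr1 phi_Yw.
rewrite !mulr0.
have [p phi_Ywk] := in_qpoly_onto (phi (Y *m w) k).
rewrite -phi_Ywk -in_qpolyM; apply/eqP; rewrite in_qpoly_eq0 //.
case: (h_k k ne_k) => [co_kf|/dvdp_mulr-> //].
have fYw : horner_mx A (f ^+ a.+1) *m (Y *m w) = 0.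
  rewrite mulmxA -commY -mulmxA; suff -> : horner_mx A (f ^+ a.+1) *m w = 0.
    by rewrite mulmx0.
  apply: (can_inj phiK); apply/ffunP => j; rewrite phi0 phiM phi_w.
  have [->|_] := eqVneq j k0; last exact: mulr0.
  by rewrite mulr1; apply/eqP; rewrite in_qpoly_eq0 // h_k0.
move/(congr1 (phi ^~ k)): fYw; rewrite phiM phi0 -phi_Ywk -in_qpolyM => /eqP.
rewrite in_qpoly_eq0 // Gauss_dvdpr ?coprimep_expr // => k_p.
exact: dvdp_mull.
Qed.

End CyclicDecomposition.

(** * Roots in the general linear group *)

Lemma coprimep_irreducible_monic (F : fieldType) (f g : {poly F}) :
  irreducible_poly f -> irreducible_poly g -> f \is monic -> g \is monic ->
  f != g -> coprimep f g.
Proof.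
move=> irr_f [_ irr_g] mon_f mon_g; apply: contraNT.
rewrite irreducible_poly_coprime // negbK => /irr_g f_g.
rewrite -eqp_monic //; apply: f_g.
by have [f_gt1 _] := irr_f; rewrite neq_ltn f_gt1 orbT.
Qed.

Lemma GL_expP (F : finFieldType) n (X alpha : {'GL_n[F]}) M :
  (X ^+ M)%g = alpha <-> GLval X ^+ M = GLval alpha.
Proof.
split=> [<-|eq_val]; first by rewrite FinRing.val_unitX.
by apply: val_inj; rewrite FinRing.val_unitX.
Qed.

Lemma exists_GL_root (F : finFieldType) n (alpha : {'GL_n[F]}) M
    (B : 'M[F]_n.-1.+1) :
  (0 < M)%N -> B ^+ M = GLval alpha ->
  exists X : {'GL_n[F]}, (X ^+ M)%g = alpha.
Proof.
move=> M_gt0 eq_B; have unitB : B \is a GRing.unit.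
  by rewrite -(unitrX_pos _ M_gt0) eq_B; apply: (valP alpha).
by exists (FinRing.unit _ unitB); apply/GL_expP.
Qed.

Section CombinatorialData.

Variables (F : finFieldType) (n : nat) (alpha : {'GL_n[F]}) (l : nat).
Variables (f : 'I_l -> {poly F}) (lam : 'I_l -> seq nat).
Hypothesis Delta : comb_data alpha f lam.

Lemma comb_data_Phi i : in_Phi (f i).
Proof. by case: Delta => [[]]. Qed.

Lemma comb_data_part_gt0 (i : 'I_l) (j : 'I_(size (lam i))) :
  (0 < nth 0%N (lam i) j)%N.
Proof.
have [_ /(_ i)[/andP[_ no0] _] _ _] := Delta.
by rewrite lt0n; apply: contraNneq no0 => <-; apply: mem_nth.
Qed.

Lemma comb_data_coprimep i j : i != j -> coprimep (f i) (f j).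
Proof.
have [[inj_f Phi_f] _ _ _] := Delta => ne_ij.
have [mon_i irr_i _] := Phi_f i; have [mon_j irr_j _] := Phi_f j.
by apply: coprimep_irreducible_monic => //; rewrite (inj_eq inj_f).
Qed.

Lemma cyclic_modulus_monic k : @cyclic_modulus F l f lam k \is monic.
Proof. by apply: monic_exp; case: (comb_data_Phi (tag k)). Qed.

Lemma size_cyclic_modulus_gt1 k : (1 < size (@cyclic_modulus F l f lam k))%N.
Proof.
have [_ [f_gt1 _] _] := comb_data_Phi (tag k).
have f0 : f (tag k) != 0 by rewrite -size_poly_gt0 ltnW.
rewrite /cyclic_modulus -(prednK (comb_data_part_gt0 (tagged k))).
by apply: leq_trans f_gt1 (dvdp_leq _ _); rewrite ?expf_neq0 // exprS dvdp_mulr.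
Qed.

(** The root found is a polynomial in alpha. *)
Lemma GL_root_of_M_power M :
  coprime #|F| M -> (0 < M)%N -> (forall i, M_power_poly M (f i)) ->
  exists X : {'GL_n[F]}, (X ^+ M)%g = alpha.
Proof.
move=> co_qM M_gt0 Mpow.
(* The exponent a i need only bound all parts for f i, so that f i ^+ a i is a
   common multiple of the moduli that involve f i. *)
pose a i := (\max_(j < size (lam i)) nth 0 (lam i) j)%N.
have root_mod i : exists s, f i ^+ a i %| s ^+ M - 'X.
  have [mon_f irr_f f_X] := comb_data_Phi i.
  have [r f_r] := (M_power_polyP M_gt0 irr_f).1 (Mpow i).
  apply: hensel_root f_r; first exact: natr_coprime_card_neq0.
  apply: coprimep_irreducible_monic => //; last exact: monicX.
  by have := irredp_XsubC (0 : F); rewrite subr0.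
have [s f_s] := fin_all_exists root_mod.
have [i j ne_ij|P f_P] := @chinese_poly F _ (fun i => f i ^+ a i) s.
  by rewrite coprimep_expl // coprimep_expr // comb_data_coprimep.
apply: (@exists_GL_root _ _ _ _ (horner_mx (GLval alpha) P)) => //.
apply/eqP; rewrite -subr_eq0 -{2}(horner_mx_X (GLval alpha)).
rewrite -rmorphXn -rmorphB /=.
have [_ _ _ dec] := Delta; apply/eqP.
apply: (horner_mx_eq0_cyclic cyclic_modulus_monic size_cyclic_modulus_gt1 dec).
move=> [i j]; apply: (@dvdp_trans _ (f i ^+ a i)).
  by apply: dvdp_exp2l; apply: leq_bigmax j.
rewrite -[P ^+ M](subrK (s i ^+ M)) -addrA dvdp_add //.
by rewrite subrXX dvdp_mulr.
Qed.

(** The summand k0 is the one of the largest part of the partition of f i; the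
    other parts for f i are strictly smaller because the parts are distinct. *)
Lemma cyclic_modulus_simple_summand i :
  uniq (lam i) ->
  exists k0 a, cyclic_modulus f k0 = f i ^+ a.+1 /\
    forall k : {i : 'I_l & 'I_(size (lam i))}, k != k0 ->
      coprimep (cyclic_modulus f k) (f i) \/ cyclic_modulus f k %| f i ^+ a.
Proof.
move=> uniq_lam.
have [_ /(_ i)[/andP[sort_lam _] ne_lam] _ _] := Delta.
have lam_gt0 : (0 < size (lam i))%N by case: (lam i) ne_lam.
pose j0 := Ordinal lam_gt0.
exists (Tagged (fun i => 'I_(size (lam i))) j0), (nth 0%N (lam i) 0).-1.
rewrite prednK ?(comb_data_part_gt0 j0) //; split=> // -[i' j] ne_k.
have [eq_i|ne_i] := eqVneq i' i; [right | left]; last first.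
  by rewrite coprimep_expl // comb_data_coprimep.
subst i'; apply: dvdp_exp2l.
have j_gt0 : (0 < j)%N.
  rewrite lt0n; apply: contraNneq ne_k => j0E.
  by apply/eqP; congr existT; apply: val_inj.
rewrite -ltnS prednK ?(comb_data_part_gt0 j0) // ltn_neqAle.
rewrite nth_uniq // -lt0n j_gt0 /=.
have trans_geq : transitive geq by move=> x y z /= le_xy /leq_trans; apply.
exact: (sorted_leq_nth trans_geq leqnn 0%N sort_lam 0%N j lam_gt0 (ltn_ord j)).
Qed.

Lemma M_power_of_GL_root M (X : {'GL_n[F]}) i :
  (0 < M)%N -> uniq (lam i) -> (X ^+ M)%g = alpha -> M_power_poly M (f i).
Proof.
move=> M_gt0 uniq_lam /GL_expP eq_X.
have [_ irr_f _] := comb_data_Phi i.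
apply/(M_power_polyP M_gt0 irr_f).
have [k0 [a [h_k0 h_k]]] := cyclic_modulus_simple_summand uniq_lam.
have [_ _ _ dec] := Delta.
have commX : comm_mx (GLval alpha) (GLval X).
  by rewrite -eq_X; apply/commr_sym/commrX.
have [v [r [Xv ann]]] := exists_common_eigenvector cyclic_modulus_monic
  size_cyclic_modulus_gt1 dec irr_f h_k0 h_k commX.
exists r; apply: ann.
have Xpow m : GLval X ^+ m *m v = horner_mx (GLval alpha) (r ^+ m) *m v.
  elim: m => [|m IHm]; first by rewrite !expr0 rmorph1.
  rewrite exprS -mulmxA IHm mulmxA -(comm_horner_mx _ commX) -mulmxA Xv.
  by rewrite mulmxA -[_ *m horner_mx _ _]rmorphM -exprSr.
by rewrite rmorphB /= mulmxBl horner_mx_X -Xpow eq_X subrr.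
Qed.

End CombinatorialData.

Theorem proposition4p5 (F : finFieldType) (M : nat) (M_ge2 : (2 <= M)%N)
    (coprime_qM : coprime #|F| M) (n : nat) (n_gt0 : (0 < n)%N)
    (alpha : {'GL_n[F]}) (l : nat) (f : 'I_l -> {poly F})
    (lam : 'I_l -> seq nat) (Delta_alpha : comb_data alpha f lam)
    (distinct_parts : forall i : 'I_l, uniq (lam i)) :
  (exists X : {'GL_n[F]}, (X ^+ M)%g = alpha) <->
  (forall i : 'I_l, M_power_poly M (f i)).
Proof.
have M_gt0 : (0 < M)%N by apply: ltnW.
split=> [[X XM] i|Mpow].
- exact: (M_power_of_GL_root Delta_alpha M_gt0 (distinct_parts i) XM).
- exact: (GL_root_of_M_power Delta_alpha coprime_qM M_gt0 Mpow).
Qed.
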